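(* Let $G$ be a finitely generated group, $\mathcal{E}$ a conjugation-invariant class of subgroups of $G$, $(H_i)$ a (possibly empty) family of subgroups of $G$, and $\sim$ an equivalence relation on $\mathcal{E}$ that is admissible relative to the $H_i$'s. Assume that $\mathcal{E}$ is sandwich-closed. Let $T$ be an $\mathcal{E}$-tree in which each $H_i$ is elliptic. If $T'$ is any $\mathcal{E}$-tree dominated by $T$, and the cylinders of $T'$ are bounded, then $T'$ is dominated by $T_c^*$.
   Context: Trees. A tree is a simplicial tree with an action of $G$ without inversions. $G_e$ denotes the stabilizer of an edge $e$. An $\mathcal{E}$-tree is a tree all of whose edge stabilizers belong to $\mathcal{E}$. A subgroup is elliptic in a tree if it fixes a point. $T$ dominates $T'$ if there is a $G$-equivariant map $T\to T'$, equivalently if every subgroup elliptic in $T$ is elliptic in $T'$. $\mathcal{E}$ is sandwich-closed if $A\subset H\subset B$ with $A,B\in\mathcal{E}$ implies $H\in\mathcal{E}$. Admissible relation. Write $A^g=g^{-1}Ag$. An equivalence relation $\sim$ on $\mathcal{E}$ is admissible relative to the $H_i$'s if for all $A,B\in\mathcal{E}$: (i) if $A\sim B$ and $g\in G$, then $A^g\sim B^g$; (ii) if $A\subset B$, then $A\sim B$; (iii) for every $\mathcal{E}$-tree $T$ in which each $H_i$ is elliptic, if $A\sim B$ and $A,B$ fix $a,b\in T$ respectively, then $G_e\sim A\sim B$ for every edge $e\subset[a,b]$. Tree of cylinders. Let $T$ be an $\mathcal{E}$-tree in which each $H_i$ is elliptic. Declare two edges $e,e'$ of $T$ equivalent if $G_e\sim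 G_{e'}$. A cylinder of $T$ is an equivalence class $Y$ of edges, identified with the union of its edges; cylinders are subtrees of $T$ and two distinct cylinders meet in at most one point. $T_c$ is the bipartite tree with vertex set $V_0(T_c)\sqcup V_1(T_c)$, where $V_0(T_c)$ is the set of vertices of $T$ belonging to at least two distinct cylinders, $V_1(T_c)$ is the set of cylinders of $T$, and there is an edge $(x,Y)$ between $x\in V_0(T_c)$ and $Y\in V_1(T_c)$ if and only if $x\in Y$. It carries the induced $G$-action. If $T$ is a single point, $T_c$ is understood to be a point. The collapsed tree of cylinders $T_c^*$ is obtained from $T_c$ by collapsing all edges whose stabilizer is not in $\mathcal{E}$. *)

(* Defs.v *)
From HB Require Import structures.
From mathcomp Require Import all_boot.
From mathcomp Require Import boolp classical_sets.
From Stdlib Require Export Relations.Relation_Operators.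

Set Implicit Arguments.
Unset Strict Implicit.
Unset Printing Implicit Defensive.

Local Open Scope classical_set_scope.
Local Open Scope group_scope.

(* Subgroups of a (possibly infinite) group *)

Definition is_subgroup (G : groupType) (A : set G) : Prop :=
  group_closed (mem A).

Definition finitely_generated (G : groupType) : Prop :=
  exists s : seq G, forall A : set G,
    is_subgroup A -> [set` s] `<=` A -> A = setT.

(* A ^ g = g^-1 A g *)
Definition conj_set (G : groupType) (A : set G) (g : G) : set G :=
  (fun a => conjg a g) @` A.

Definition conj_invariant (G : groupType) (E : set (set G)) : Prop :=
  forall A g, E A -> E (conj_set A g).

Definition sandwich_closed (G : groupType) (E : set (set G)) : Prop :=
  forall A K B : set G, E A -> E B -> is_subgroup K ->
    A `<=` K -> K `<=` B -> E K.

Definition equivalence_on (X : Type) (E : set X) (R : X -> X -> Prop) : Prop :=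
  [/\ forall A, E A -> R A A,
      forall A B, E A -> E B -> R A B -> R B A &
      forall A B C, E A -> E B -> E C -> R A B -> R B C -> R A C].

(* A 1-dimensional simplicial complex, given by its vertices and the adjacency
   relation, with a simplicial left action of G.  An edge is represented by
   either of the two ordered pairs of its endpoints. *)
Record ggraph (G : groupType) := GGraph {
  vert :> choiceType;
  adj : rel vert;
  act : G -> vert -> vert;
  adj_sym : symmetric adj;
  adj_irr : irreflexive adj;
  act1 : forall x, act 1 x = x;
  actM : forall g h x, act (g * h) x = act g (act h x);
  adj_act : forall g x y, adj (act g x) (act g y) = adj x y
}.
Arguments adj {G _} _ _ : rename.
Arguments act {G _} _ _ : rename.

(* [segment x p y]: x :: p lists the successive vertices of an injective edge
   path from x to y; in a tree it is the segment [x, y]. *)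
Definition segment (G : groupType) (T : ggraph G) (x : T) (p : seq T) (y : T) :
  bool := [&& path adj x p, last x p == y & uniq (x :: p)].

Definition connected (G : groupType) (T : ggraph G) : Prop :=
  forall x y : T, exists2 p, path adj x p & last x p = y.

(* the simple cyclic sequences [:: x] and [:: x; y] are not circuits *)
Definition acyclic (G : groupType) (T : ggraph G) : Prop :=
  forall c : seq T, ucycle adj c -> size c <= 2.

Definition without_inversions (G : groupType) (T : ggraph G) : Prop :=
  forall (g : G) (x y : T), adj x y -> ~ (act g x = y /\ act g y = x).

Definition is_tree (G : groupType) (T : ggraph G) : Prop :=
  [/\ inhabited T, connected T, acyclic T & without_inversions T].

Definition fixes (G : groupType) (T : ggraph G) (A : set G) (x : T) : Prop :=
  forall g, A g -> act g x = x.

(* In the absence of inversions, a subgroup that fixes an interior point of an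
   edge fixes its endpoints, so it is enough to consider vertices. *)
Definition elliptic (G : groupType) (T : ggraph G) (A : set G) : Prop :=
  exists x : T, fixes A x.

(* pointwise stabilizer; in the absence of inversions, it is also the setwise
   stabilizer *)
Definition edge_stab (G : groupType) (T : ggraph G) (e : T * T) : set G :=
  [set g | act g e.1 = e.1 /\ act g e.2 = e.2].

Definition edges (G : groupType) (T : ggraph G) : set (T * T) :=
  [set e | adj e.1 e.2].
Arguments edges {G} T _.

Definition is_Etree (G : groupType) (E : set (set G)) (T : ggraph G) : Prop :=
  is_tree T /\ forall e : T * T, edges T e -> E (edge_stab e).

(* A G-equivariant map sending vertices to vertices and each edge xy linearly
   onto the segment from the image of x to the image of y, whose vertices are
   [mapv x :: mape x y]. *)
Record gmap (G : groupType) (T T' : ggraph G) := GMap {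
  mapv : T -> T';
  mape : T -> T -> seq T';
  mape_segment : forall x y, adj x y -> segment (mapv x) (mape x y) (mapv y);
  mape_rev : forall x y, adj x y ->
    mapv y :: mape y x = rev (mapv x :: mape x y);
  mapv_act : forall g x, mapv (act g x) = act g (mapv x);
  mape_act : forall g x y, adj x y ->
    mape (act g x) (act g y) = map (act g) (mape x y)
}.

Definition dominates (G : groupType) (T T' : ggraph G) : Prop :=
  inhabited (gmap T T').

Record admissible (G : groupType) (E : set (set G)) (I : Type)
    (H : I -> set G) (R : set G -> set G -> Prop) : Prop := Admissible {
  admissible_conj : forall A B g, E A -> E B ->
    R A B -> R (conj_set A g) (conj_set B g);
  admissible_sub : forall A B, E A -> E B -> A `<=` B -> R A B;
  admissible_segment : forall T : ggraph G,
    is_Etree E T -> (forall i, elliptic T (H i)) ->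
    forall A B, E A -> E B -> R A B ->
    forall (a b : T) (p : seq T), fixes A a -> fixes B b -> segment a p b ->
    forall x y : T, infix [:: x; y] (a :: p) ->
    R (edge_stab (x, y)) A /\ R A B
}.

(* Cylinders, as sets of edges; they contain both ordered pairs representing
   an edge, or neither. *)
Definition cylinder_of (G : groupType) (R : set G -> set G -> Prop)
    (T : ggraph G) (e : T * T) : set (T * T) :=
  [set e' | edges T e' /\ R (edge_stab e) (edge_stab e')].

Definition cylinders (G : groupType) (R : set G -> set G -> Prop)
    (T : ggraph G) : set (set (T * T)) :=
  [set cylinder_of R e | e in edges T].
Arguments cylinders {G} R T _.

Definition cylinder_points (G : groupType) (T : ggraph G)
    (Y : set (T * T)) : set T :=
  [set x | exists y, Y (x, y) \/ Y (y, x)].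

Definition bounded (G : groupType) (T : ggraph G) (S : set T) : Prop :=
  exists n, forall x y, S x -> S y ->
    exists p, [/\ path adj x p, last x p = y & size p <= n].

Definition act_edge (G : groupType) (T : ggraph G) (g : G) (e : T * T) :
  T * T := (act g e.1, act g e.2).

Lemma actK (G : groupType) (T : ggraph G) (g : G) :
  cancel (@act G T g) (act g^-1).
Proof. by move=> x; rewrite -actM mulVg act1. Qed.

Lemma actVK (G : groupType) (T : ggraph G) (g : G) :
  cancel (@act G T g^-1) (act g).
Proof. by move=> x; rewrite -actM mulgV act1. Qed.

Lemma edges_act (G : groupType) (T : ggraph G) (g : G) (e : T * T) :
  edges T (act_edge g e) <-> edges T e.
Proof. by rewrite /edges /= adj_act. Qed.

Lemma edge_stab_act (G : groupType) (T : ggraph G) (g : G) (e : T * T) :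
  edge_stab (act_edge g e) = conj_set (edge_stab e) g^-1.
Proof.
apply/seteqP; split=> [h [/= h1 h2]|_ [h [h1 h2] <-]].
  exists (conjg h g); last by rewrite conjgK.
  by split; rewrite /conjg !actM ?h1 ?h2 actK.
by split; rewrite /conjg invgK !actM /= actK ?h1 ?h2.
Qed.

Lemma act_edgeVK (G : groupType) (T : ggraph G) (g : G) (e : T * T) :
  act_edge g (act_edge g^-1 e) = e.
Proof. by case: e => x y; rewrite /act_edge /= !actVK. Qed.

Lemma image_act1 (G : groupType) (T : ggraph G) (Y : set (T * T)) :
  act_edge 1 @` Y = Y.
Proof.
apply/seteqP; split=> [_ [[x y] Yxy <-]|[x y] Yxy].
  by rewrite /act_edge /= !act1.
by exists (x, y); rewrite // /act_edge /= !act1.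
Qed.

Lemma image_actM (G : groupType) (T : ggraph G) (g h : G) (Y : set (T * T)) :
  act_edge (g * h) @` Y = act_edge g @` (act_edge h @` Y).
Proof.
rewrite image_comp; congr (_ @` _); apply/funext => -[x y].
by rewrite /act_edge /= !actM.
Qed.

Section TreeOfCylinders.
Context (G : groupType) (E : set (set G)) (I : Type) (H : I -> set G).
Context (R : set G -> set G -> Prop) (T : ggraph G).

Definition Tc_V0 : set T :=
  [set x | exists Y Y', [/\ cylinders R T Y, cylinders R T Y', Y <> Y',
     cylinder_points Y x & cylinder_points Y' x]].

Definition Tc_V1 : set (set (T * T)) := cylinders R T.

(* an extra vertex, present only when T is a single point (in which case T
   has no cylinder, and T_c is a point by convention) *)
Definition Tc_point : set unit := [set _ | forall x y : T, x = y].

Definition Tc_vert : choiceType := (Tc_V0 + Tc_V1 + Tc_point)%type.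

Definition Tc_adj : rel Tc_vert := fun u v =>
  match u, v with
  | inl (inl x), inl (inr Y) => val x \in cylinder_points (val Y)
  | inl (inr Y), inl (inl x) => val x \in cylinder_points (val Y)
  | _, _ => false
  end.

Context (adm : admissible E H R) (treeT : is_Etree E T).

Lemma cylinder_of_act (g : G) (e : T * T) : edges T e ->
  act_edge g @` cylinder_of R e = cylinder_of R (act_edge g e).
Proof.
case: treeT => _ ET edge_e; apply/seteqP; split=> [_ [e' [edge_e' Ree'] <-]|].
  split; first exact/edges_act.
  by rewrite !edge_stab_act; apply: (admissible_conj adm) => //; apply: ET.
move=> e' [edge_e' Ree'].
exists (act_edge g^-1 e'); last exact: act_edgeVK.
split; first exact/edges_act.
have -> : edge_stab e = conj_set (edge_stab (act_edge g e)) g^-1^-1.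
  rewrite -edge_stab_act; congr edge_stab; case: (e) => x y.
  by rewrite /act_edge /= !actK.
rewrite [X in R _ X]edge_stab_act.
apply: (admissible_conj adm) => //; apply: ET => //.
exact/edges_act.
Qed.

Lemma Tc_V1_act (g : G) (Y : set (T * T)) : Tc_V1 Y -> Tc_V1 (act_edge g @` Y).
Proof.
case=> e edge_e <-; exists (act_edge g e); first exact/edges_act.
by rewrite cylinder_of_act.
Qed.

Lemma cylinder_points_act (g : G) (x : T) (Y : set (T * T)) :
  cylinder_points (act_edge g @` Y) (act g x) <-> cylinder_points Y x.
Proof.
have inj := can_inj (@actK G T g).
split=> [[y [|]]|[y [Yxy|Yyx]]].
- by case=> -[a b] Yab [/inj <- _]; exists b; left.
- by case=> -[a b] Yab [_ /inj <-]; exists a; right.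
- by exists (act g y); left; exists (x, y).
- by exists (act g y); right; exists (y, x).
Qed.

Lemma Tc_V0_act (g : G) (x : T) : Tc_V0 x -> Tc_V0 (act g x).
Proof.
case=> Y [Y' [cY cY' neqY Yx Y'x]].
exists (act_edge g @` Y), (act_edge g @` Y'); split.
- exact: Tc_V1_act.
- exact: Tc_V1_act.
- move=> eqY; apply: neqY.
  by rewrite -[Y]image_act1 -[Y']image_act1 -(mulVg g) !image_actM eqY.
- exact/cylinder_points_act.
- exact/cylinder_points_act.
Qed.

Definition Tc_act (g : G) (u : Tc_vert) : Tc_vert :=
  match u with
  | inl (inl x) =>
      inl (inl (SigSub (mem_set (Tc_V0_act g (set_mem (valP x))))))
  | inl (inr Y) =>
      inl (inr (SigSub (mem_set (Tc_V1_act g (set_mem (valP Y))))))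
  | inr p => inr p
  end.

Lemma Tc_adj_sym : symmetric Tc_adj.
Proof. by case=> [[x|Y]|p] [[x'|Y']|p']. Qed.

Lemma Tc_adj_irr : irreflexive Tc_adj.
Proof. by case=> [[x|Y]|p]. Qed.

Lemma Tc_act1 (u : Tc_vert) : Tc_act 1 u = u.
Proof.
case: u => [[x|Y]|p] //=; congr inl.
  by congr inl; apply: val_inj; rewrite /= act1.
by congr inr; apply: val_inj; rewrite /= image_act1.
Qed.

Lemma Tc_actM (g h : G) (u : Tc_vert) : Tc_act (g * h) u = Tc_act g (Tc_act h u).
Proof.
case: u => [[x|Y]|p] //=; congr inl.
  by congr inl; apply: val_inj; rewrite /= actM.
by congr inr; apply: val_inj; rewrite /= image_actM.
Qed.

Lemma Tc_adj_act (g : G) (u v : Tc_vert) :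
  Tc_adj (Tc_act g u) (Tc_act g v) = Tc_adj u v.
Proof.
by case: u v => [[x|Y]|p] [[x'|Y']|p'] //=;
  apply/idP/idP => /set_mem /cylinder_points_act /mem_set.
Qed.

Definition tree_of_cylinders : ggraph G :=
  GGraph Tc_adj_sym Tc_adj_irr Tc_act1 Tc_actM Tc_adj_act.

End TreeOfCylinders.

(* The graph obtained by collapsing the edges that satisfy K: its vertices are
   the classes of vertices joined by collapsed edges. *)
Section Collapse.
Context (G : groupType) (T : ggraph G) (K : set (T * T)).

Definition collapse_class (x : T) : set T :=
  [set y | clos_refl_sym_trans T (fun u v => edges T (u, v) /\ K (u, v)) x y].

Definition collapse_vert : choiceType := range collapse_class.

Definition collapse_adj : rel collapse_vert := fun C D =>
  `[< C <> D /\ exists x y, [/\ val C x, val D y & adj x y] >].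

Context (Kact : forall g e, K e -> K (act_edge g e)).

Lemma collapse_class_act (g : G) (x : T) :
  act g @` collapse_class x = collapse_class (act g x).
Proof.
have sub h u v : collapse_class u v -> collapse_class (act h u) (act h v).
  elim=> [a b [eab Kab]|a|a b _ IH|a b c _ IH1 _ IH2].
  - apply: rst_step; split; first by rewrite /edges /= adj_act.
    exact: Kact Kab.
  - exact: rst_refl.
  - exact: rst_sym.
  - exact: rst_trans IH1 IH2.
apply/seteqP; split=> [_ [y xy <-]|y xy]; first exact: sub.
by exists (act g^-1 y); rewrite ?actVK // -[x](actK g); apply: sub.
Qed.

Lemma collapse_vert_act (g : G) (C : collapse_vert) :
  act g @` val C \in range collapse_class.
Proof.
have [x _ <-] := set_mem (valP C).
by apply: mem_set; exists (act g x); rewrite ?collapse_class_act.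
Qed.

Definition collapse_act (g : G) (C : collapse_vert) : collapse_vert :=
  SigSub (collapse_vert_act g C).

Lemma collapse_adj_sym : symmetric collapse_adj.
Proof.
suff sub C D : collapse_adj C D -> collapse_adj D C.
  by move=> C D; apply/idP/idP; apply: sub.
move=> /asboolP[neq [x [y [Cx Dy xy]]]]; apply/asboolP; split.
  exact/nesym.
by exists y, x; rewrite adj_sym.
Qed.

Lemma collapse_adj_irr : irreflexive collapse_adj.
Proof. by move=> C; apply/negP => /asboolP[]. Qed.

Lemma collapse_act1 (C : collapse_vert) : collapse_act 1 C = C.
Proof.
apply: val_inj => /=; rewrite -[RHS]image_id; congr (_ @` _).
by apply/funext => x; rewrite act1.
Qed.

Lemma collapse_actM (g h : G) (C : collapse_vert) :
  collapse_act (g * h) C = collapse_act g (collapse_act h C).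
Proof.
apply: val_inj => /=; rewrite image_comp; congr (_ @` _).
by apply/funext => x /=; rewrite actM.
Qed.

Lemma collapse_adj_act (g : G) (C D : collapse_vert) :
  collapse_adj (collapse_act g C) (collapse_act g D) = collapse_adj C D.
Proof.
have sub h C' D' :
    collapse_adj C' D' -> collapse_adj (collapse_act h C') (collapse_act h D').
  move=> /asboolP[neq [x [y [Cx Dy xy]]]]; apply/asboolP; split.
    move=> eqCD; apply: neq.
    by rewrite -[C']collapse_act1 -[D']collapse_act1 -(mulVg h)
      !collapse_actM eqCD.
  by exists (act h x), (act h y); rewrite adj_act; split=> //;
    [exists x | exists y].
apply/idP/idP; last exact: sub.
by move=> /(sub g^-1); rewrite -!collapse_actM mulVg !collapse_act1.
Qed.

Definition collapse : ggraph G :=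
  GGraph collapse_adj_sym collapse_adj_irr collapse_act1 collapse_actM
    collapse_adj_act.

End Collapse.

Lemma edge_stab_notin_act (G : groupType) (E : set (set G)) (T : ggraph G)
    (Econj : conj_invariant E) (g : G) (e : T * T) :
  ~ E (edge_stab e) -> ~ E (edge_stab (act_edge g e)).
Proof.
move=> nE Ege; apply: nE.
suff -> : edge_stab e = conj_set (edge_stab (act_edge g e)) g by apply: Econj.
rewrite -[g in conj_set _ g]invgK -edge_stab_act; congr edge_stab.
by case: e Ege => x y _; rewrite /act_edge /= !actK.
Qed.

Definition collapsed_tree_of_cylinders (G : groupType) (E : set (set G))
    (I : Type) (H : I -> set G) (R : set G -> set G -> Prop) (T : ggraph G)
    (Econj : conj_invariant E) (adm : admissible E H R)
    (treeT : is_Etree E T) : ggraph G :=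
  @collapse G (tree_of_cylinders adm treeT) [set e | ~ E (edge_stab e)]
    (fun g e => @edge_stab_notin_act G E _ Econj g e).

(* Main.v *)
Require Import Defs.
From mathcomp Require Import all_boot.
From mathcomp Require Import boolp classical_sets.

Set Implicit Arguments.
Unset Strict Implicit.
Unset Printing Implicit Defensive.

Local Open Scope classical_set_scope.

(** By equivariance it is enough to map the vertices of [T_c], compatibly with
    the collapse, since the edges of [T_c^*] can then be sent to geodesics; so
    vertex stabilizers of [T_c] must be elliptic in [T'].
    The stabilizer of a vertex of [T] is elliptic because [T] dominates [T'].
    The stabilizer of a cylinder [Y] of [T], with class [C], preserves the
    corresponding cylinder of [T'], which is bounded, hence it fixes a center of
    that cylinder. If no edge of [T'] has its stabilizer in [C], then by (iii)
    the groups in [C] that are elliptic in [T'] all fix the same single vertex,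
    which is therefore fixed by the stabilizer of [Y].
    Finally, the stabilizer of an edge of [T_c] contains some [G_e]; if it also
    fixes an edge of [T'], it is sandwiched between two elements of [E]. So a
    collapsed edge has a stabilizer fixing no edge of [T'], and its endpoints
    have the same image. *)

(** * Segments, centers and fixed points in trees *)

Section Trees.
Context {G : groupType} {T : ggraph G}.
Implicit Types (x y z : T) (p q : seq T).

Lemma act_inj (g : G) : injective (@act G T g).
Proof. exact: can_inj (@actK G T g). Qed.

Lemma path_segment x p : path adj x p ->
  exists2 q, segment x q (last x p) & {subset q <= p}.
Proof.
by case/shortenP=> q pq uq sub; exists q => //; rewrite /segment pq eqxx.
Qed.

Lemma segment_act (g : G) x p y :
  segment x p y -> segment (act g x) (map (act g) p) (act g y).
Proof.
case/and3P=> pp /eqP lp up; apply/and3P; split.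
- by rewrite path_map; apply: sub_path pp => a b /=; rewrite adj_act.
- by rewrite last_map lp.
- by rewrite -map_cons map_inj_uniq //; apply: act_inj.
Qed.

(** The list of a segment omits its starting vertex, so [rev p] alone would not list the reversed
    segment; its list is the tail of [rev (x :: p)]. *)
Lemma segment_rev x p y : segment x p y ->
  exists2 q, rev (x :: p) = y :: q & segment y q x.
Proof.
case/and3P=> pp /eqP lp up; exists (rev (belast x p)).
  by rewrite lastI rev_rcons lp.
have e : y :: rev (belast x p) = rev (x :: p) by rewrite [in RHS]lastI rev_rcons lp.
apply/and3P; split.
- rewrite -{1}lp rev_path; apply: sub_path pp => a b /=; by rewrite adj_sym.
- by rewrite -(last_cons y) e rev_cons last_rcons.
- by rewrite e rev_uniq.
Qed.

Lemma segment_cat x p y q z : segment x (p ++ y :: q) z -> segment y q z.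
Proof.
case/and3P; rewrite cat_path last_cat /= => /and3P[_ _ pq] lq.
case/andP=> _; rewrite cat_uniq => /and3P[_ _ uq].
by apply/and3P; split.
Qed.

Hypothesis treeT : is_tree T.

Lemma segment_exists x y : exists p, segment x p y.
Proof.
have [_ conn _ _] := treeT; have [p pp <-] := conn x y.
by have [q sq _] := path_segment pp; exists q.
Qed.

(** If the first steps [a] and [b] differ, following [p] to [y] and returning along [q] gives a path
    from [a] to [b] avoiding [x]; shortened and closed up at [x], it is a circuit with at least
    three vertices. *)
Lemma segment_unique x p q y : segment x p y -> segment x q y -> p = q.
Proof.
have [_ _ acyc _] := treeT.
elim: p x q => [|a p IH] x [|b q] //.
- case/and3P=> _ /eqP/= <- _ /and3P[_ /eqP/= l /andP[+ _]].
  by rewrite -{1}l mem_last.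
- case/and3P=> _ /eqP/= l /andP[+ _] /and3P[_ /eqP/= e _].
  by rewrite e -l mem_last.
case/and3P=> /= /andP[xa pp] /eqP lp /andP[xp up].
case/and3P=> /= /andP[xb pq] /eqP lq /andP[xq uq].
have [ab|/eqP nab] := eqVneq a b.
  by subst b; congr cons; apply: (IH a); apply/and3P; split=> //; apply/eqP.
have [q' sr e] : exists2 q', segment y q' b & rev (b :: q) = y :: q'.
  have [|q' e s] := @segment_rev b q y; last by exists q'.
  by apply/and3P; split=> //; apply/eqP.
case/and3P: sr => pq' /eqP lq' _.
have /path_segment[r] : path adj a (p ++ q') by rewrite cat_path pp lp.
rewrite last_cat lp lq' => /and3P[pr /eqP lr ur] sub.
have /acyc : ucycle adj (x :: a :: r).
  apply/andP; split.
    rewrite /= rcons_path -/(last a r) xa pr /=.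
    by rewrite lr adj_sym.
  rewrite [uniq _]/= -/(uniq (a :: r)) ur andbT inE negb_or.
  move: xp; rewrite inE negb_or => /andP[-> xp] /=.
  apply/negP => /sub; rewrite mem_cat (negPf xp) /= => xq'.
  move: xq; rewrite -mem_rev e inE xq' orbT //.
by case: r lr {pr ur sub} => //= /nab.
Qed.

(** A translate of the segment by [A] has the same endpoints, so by uniqueness it is the same list,
    vertex by vertex. *)
Lemma segment_fixed (A : set G) x p y :
  fixes A x -> fixes A y -> segment x p y -> forall z, z \in p -> fixes A z.
Proof.
move=> Ax Ay sp z zp g Ag; have := segment_act g sp; rewrite Ax // Ay //.
move/segment_unique => /(_ _ sp); elim: p zp {sp} => //= a p IH.
by rewrite inE => /orP[/eqP->|/IH{}IH] [].
Qed.

(** Shortening the concatenated path through [z] yields the unique segment from [x] to [y]. *)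
Lemma segment_through x p y u z q1 q2 : segment x p y -> u \in p ->
  segment x q1 z -> segment z q2 y -> (u \in q1) || (u \in q2).
Proof.
move=> sp up /and3P[p1 /eqP l1 _] /and3P[p2 /eqP l2 _].
have /path_segment[q] : path adj x (q1 ++ q2) by rewrite cat_path p1 l1.
rewrite last_cat l1 l2 => /segment_unique/(_ sp) -> sub.
by rewrite -mem_cat sub.
Qed.

(** Only an upper bound: [S] lies in the closed ball of radius [n] about [x]. *)
Let radius (S : set T) (n : nat) x :=
  forall s, S s -> forall p, segment x p s -> size p <= n.

(* The centers of [S] are the vertices minimizing the radius; two of them are
   at distance at most 1, as any vertex strictly between them is closer to each
   point of [S] than one of them. *)
Lemma centers_adj (S : set T) (n : nat) x y : S !=set0 ->
  (forall z m, radius S m z -> n <= m) ->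
  radius S n x -> radius S n y -> x = y \/ adj x y.
Proof.
move=> [s0 Ss0] minn rx ry; have [[|u [|w p]] sp] := segment_exists x y.
- by left; case/and3P: sp => _ /eqP.
- by right; case/and3P: sp => /=; rewrite andbT => xu /eqP <-.
have short v q s : S s -> segment v q s -> u \in q -> forall r,
    segment u r s -> size r < size q.
  move=> Ss + /splitPr e; case: e => p1 p2 /segment_cat s2 r sr.
  by rewrite (segment_unique sr s2) size_cat /= addnS ltnS leq_addl.
have closer s r : S s -> segment u r s -> size r < n.
  move=> Ss sr.
  have [q1 s1] := segment_exists x s; have [q2 s2] := segment_exists y s.
  have [q2' e s2'] := segment_rev s2.
  have := segment_through sp (mem_head _ _) s1 s2'.
  case/orP=> uq.
    exact: leq_trans (short _ _ _ Ss s1 uq _ sr) (rx _ Ss _ s1).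
  apply: leq_trans (short _ _ _ Ss s2 _ _ sr) (ry _ Ss _ s2).
  have : u \in y :: q2 by rewrite -mem_rev e inE uq orbT.
  rewrite inE => /orP[/eqP uy|//]; exfalso.
  case/and3P: sp => _ /eqP/= ly /and3P[_ + _].
  by rewrite uy -ly mem_last.
have [r0 /(closer _ _ Ss0) n0] := segment_exists u s0.
(* Nonemptiness of [S] enters through [n0]: it makes [n] positive, so [n.-1] is strictly smaller and
   contradicts minimality. *)
have /minn : radius S n.-1 u by move=> s Ss r /(closer _ _ Ss); case: (n) n0.
by case: (n) n0 => //= m _; rewrite ltnn.
Qed.

(** [A] permutes the centers of [S], which are pairwise equal or adjacent. If [g] moved a center
    [x], then [x], [g x], [g (g x)] would form a triangle, or [g] would invert an edge. *)
Lemma bounded_fixed_point (A : set G) (S : set T) : is_subgroup A ->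
  S !=set0 -> bounded S -> (forall g x, A g -> S (act g x) <-> S x) ->
  elliptic T A.
Proof.
move=> [A1 AB] S0 [N bS] AS.
have AV g : A g -> A g^-1%g.
  by move=> Ag; have := AB 1%g g; rewrite !inE mul1g; apply=> //; exact: set_mem.
have [s0 Ss0] := S0.
have exn : exists n, `[< exists x, radius S n x >].
  exists N; apply/asboolP; exists s0 => s Ss p sp.
  have [q [/path_segment[r + sub] lq]] := bS _ _ Ss0 Ss.
  rewrite lq => /[dup] /and3P[_ _ /andP[_ ur]] sr.
  rewrite (segment_unique sp sr); apply: leq_trans.
  exact: uniq_leq_size.
case: (ex_minnP exn) => n /asboolP[x rx] minn.
have {}minn z m : radius S m z -> n <= m.
  by move=> rz; apply: minn; apply/asboolP; exists z.
have rA g z : A g -> radius S n z -> radius S n (act g z).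
  move=> Ag rz s Ss p sp; have := segment_act g^-1%g sp; rewrite actK => sp'.
  rewrite -(size_map (act g^-1%g)); apply: rz sp'.
  by apply/(AS _ _ Ag); rewrite actVK.
have [_ _ acyc inv] := treeT.
exists x => g Ag; apply/eqP; apply: contraT => /eqP neq.
have rgx := rA g _ Ag rx.
have rggx := rA g _ Ag rgx.
have [e|xgx] := centers_adj S0 minn rx rgx; first by rewrite -e in neq.
have [e|xggx] := centers_adj S0 minn rx rggx.
  by case: (inv g x (act g x)).
have /acyc// : ucycle adj [:: x; act g x; act g (act g x)].
rewrite /ucycle /= xgx adj_act xgx adj_sym xggx /= !inE.
have ne y z : adj y z -> y != z by apply: contraTneq => ->; rewrite adj_irr.
by rewrite negb_or !ne ?adj_act.
Qed.

End Trees.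

(** * Fixed edges, stabilizers and equivariant vertex maps *)

Lemma fixes_edge (G : groupType) (T : ggraph G) (A : set G) (x y : T) :
  is_tree T -> fixes A x -> fixes A y -> x <> y ->
  exists2 e, edges T e & A `<=` edge_stab e.
Proof.
move=> treeT Ax Ay neq; have [[|z p] sp] := segment_exists treeT x y.
  by case/and3P: sp => _ /eqP.
have Az := segment_fixed treeT Ax Ay sp (mem_head _ _).
exists (x, z); first by case/and3P: sp => /= /andP[].
by move=> g Ag; split; [apply: Ax|apply: Az].
Qed.

Lemma stab_subgroup {G : groupType} {X : Type} (a : G -> X -> X) (x : X) :
  (forall y, a 1%g y = y) -> (forall g h y, a (g * h)%g y = a g (a h y)) ->
  is_subgroup [set g | a g x = x].
Proof.
move=> a1 aM; split; first by apply/mem_set; apply: a1.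
move=> g h /set_mem/= gx /set_mem/= hx; apply/mem_set => /=.
by rewrite -{1}hx -aM mulgVK.
Qed.

Lemma edge_stab_subgroup (G : groupType) (T : ggraph G) (e : T * T) :
  is_subgroup (edge_stab e).
Proof.
have -> : edge_stab e = [set g | act_edge g e = e].
  by case: e => x y; apply/seteqP; split=> [g [/= gx gy]|g [gx gy]] //;
    rewrite /act_edge /= gx gy.
apply: stab_subgroup => [[x y]|g h [x y]]; rewrite /act_edge /= ?act1 //.
by rewrite !actM.
Qed.

(* Choose images of orbit representatives and extend by equivariance. *)
Lemma equivariant_map (G : groupType) (X T : ggraph G) :
  (forall x : X, elliptic T [set g | act g x = x]) ->
  exists f : X -> T, forall g x, f (act g x) = act g (f x).
Proof.
move=> /choice[c cP].
pose O (x : X) := fun y : X => `[< exists g, act g y = x >].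
have OA g x : O (act g x) = O x.
  apply/funext => y; apply/asbool_equiv_eq; split=> -[h hy].
    by exists (g^-1 * h)%g; rewrite actM hy actK.
  by exists (g * h)%g; rewrite actM hy.
pose rep x := choose (O x) x.
have Oxx x : O x x by apply/asboolP; exists 1%g; rewrite act1.
(* [choose] depends only on the predicate, not on the default element, so [rep] is constant on
   orbits. *)
have repA g x : rep (act g x) = rep x.
  by rewrite /rep OA; apply: choose_id => //; rewrite -(OA g).
have /choice[t tP] : forall x, exists g, act g (rep x) = x.
  by move=> x; apply/asboolP; apply: (chooseP (Oxx x)).
exists (fun x => act (t x) (c (rep x))) => g x.
(* [t (act g x)] and [g * t x] both carry [rep x] to [act g x], so they differ by an element
   stabilizing [rep x], which fixes [c (rep x)]. *)
rewrite repA -actM; apply: (@act_inj _ _ (g * t x)^-1%g).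
rewrite actK -actM; apply: cP => /=.
have := tP (act g x); rewrite repA actM => ->.
by rewrite -[RHS](actK (g * t x)%g) [in RHS]actM tP.
Qed.

(** * Stabilizers of cylinders and of edges of the tree of cylinders *)

Section Cylinders.
Context {G : groupType} {E : set (set G)} {I : Type} {H : I -> set G}.
Context {R : set G -> set G -> Prop}.
Hypothesis Econj : conj_invariant E.
Hypothesis Requiv : equivalence_on E R.
Context (Radm : admissible E H R).

Lemma cylinder_of_eq (T : ggraph G) (e e' : T * T) : is_Etree E T ->
  edges T e -> edges T e' -> R (edge_stab e) (edge_stab e') ->
  cylinder_of R e = cylinder_of R e'.
Proof.
move=> [_ ET] /ET Ee /ET Ee' ee'; have [_ Rsym Rtrans] := Requiv.
apply/seteqP; split=> f [fE ef]; split=> //; move/ET: (fE) => Ef.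
  by apply: (Rtrans _ _ _ Ee' Ee Ef) => //; apply: Rsym.
exact: (Rtrans _ _ _ Ee Ee' Ef).
Qed.

Lemma cylinder_stab_elliptic (T T' : ggraph G) (Y : set (T * T)) :
  is_Etree E T -> is_Etree E T' -> (forall i, elliptic T' (H i)) ->
  dominates T T' ->
  (forall Y', cylinders R T' Y' -> bounded (cylinder_points Y')) ->
  cylinders R T Y -> elliptic T' [set g | act_edge g @` Y = Y].
Proof.
move=> ET ET' HT' [f] bnd [e eE <-].
have [Rrefl Rsym Rtrans] := Requiv.
have Ee : E (edge_stab e) by apply: ET.2.
have conjR g : act_edge g @` cylinder_of R e = cylinder_of R e ->
    R (edge_stab e) (conj_set (edge_stab e) g^-1).
  move=> ge; have : cylinder_of R e (act_edge g e).
    by rewrite -ge; exists e => //; split=> //; apply: Rrefl.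
  by case=> _; rewrite edge_stab_act.
have [[e' [e'E ee']]|noe'] :=
  pselect (exists e' : T' * T', edges T' e' /\ R (edge_stab e) (edge_stab e')).
  have Ee' : E (edge_stab e') by apply: ET'.2.
  apply: (@bounded_fixed_point _ _ ET'.1 _ (cylinder_points (cylinder_of R e'))).
  - apply: (@stab_subgroup _ _ (fun g Y => act_edge g @` Y)) => *.
      exact: image_act1.
    exact: image_actM.
  - by exists e'.1, e'.2; left; rewrite -surjective_pairing; split=> //;
      apply: Rrefl.
  - by apply: bnd; exists e'.
  (* The cylinder of [e'] is preserved by [g] because the stabilizers of [e'], [e], [g e] and [g e']
     are successively equivalent. *)
  move=> g x /= /conjR ge.
  rewrite -[X in _ <-> X](cylinder_points_act g).
  rewrite (cylinder_of_act Radm ET') //.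
  rewrite (@cylinder_of_eq _ e' (act_edge g e')) //; first exact/edges_act.
  rewrite edge_stab_act.
  have Ege := @Econj _ g^-1%g Ee; have Ege' := @Econj _ g^-1%g Ee'.
  apply: (Rtrans _ _ _ Ee' Ee Ege'); first exact: Rsym.
  apply: (Rtrans _ _ _ Ee Ege Ege') => //.
  exact: (admissible_conj Radm).
exists (mapv f e.1) => g /= /conjR ge; apply/eqP; apply: contraT => /eqP neq.
have Ege := @Econj _ g^-1%g Ee.
have fix1 : fixes (edge_stab e) (mapv f e.1).
  by move=> h [h1 _]; rewrite -mapv_act h1.
have fix2 : fixes (conj_set (edge_stab e) g^-1%g) (act g (mapv f e.1)).
  rewrite -mapv_act -edge_stab_act => h [/= h1 _]; by rewrite -mapv_act h1.
have [[|z p] sp] := segment_exists ET'.1 (mapv f e.1) (act g (mapv f e.1)).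
  by case: neq; case/and3P: sp => _ /eqP.
have adjz : edges T' (mapv f e.1, z) by case/and3P: sp => /= /andP[].
(* By (iii), the first edge of the segment from [mapv f e.1] to its translate lies in the class of
   [e]. *)
case: noe'; exists (mapv f e.1, z); split=> //.
apply: Rsym => //; first exact: ET'.2.
apply: (admissible_segment Radm ET' HT' Ee Ege ge fix1 fix2 sp _).1.
by rewrite /= !eqxx prefix0s.
Qed.

(** A vertex [x] of [Y] is an endpoint of some edge [e'] of [Y]; the stabilizer of [e'] fixes [x],
    and it preserves [Y] since [Y] is the cylinder of [e']. *)
Lemma Tc_edge_stab (T : ggraph G) (ET : is_Etree E T)
    (e : tree_of_cylinders Radm ET * tree_of_cylinders Radm ET) :
  adj e.1 e.2 -> exists2 e', edges T e' & edge_stab e' `<=` edge_stab e.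
Proof.
have [Rrefl _ _] := Requiv.
have main (x : Tc_V0 R (T:=T)) (Y : Tc_V1 R (T:=T)) :
    val x \in cylinder_points (val Y) ->
    exists2 e', edges T e' & edge_stab e' `<=`
      edge_stab (T := tree_of_cylinders Radm ET)
        (inl (inl x), inl (inr Y)).
  move=> /set_mem/= xY.
  have [e' [e'Y xe']] : exists e', val Y e' /\ (e'.1 = val x \/ e'.2 = val x).
    case: xY => y [xy|yx]; first by exists (val x, y); split=> //; left.
    by exists (y, val x); split=> //; right.
  have [e0 e0E e0Y] := set_mem (valP Y).
  have [e'E Re'] : cylinder_of R e0 e' by rewrite e0Y.
  exists e' => // g [g1 g2].
  split; congr (inl (_ _)); apply: val_inj => /=.
    by case: xe' => <-.
  rewrite -e0Y (@cylinder_of_eq _ e0 e') // (cylinder_of_act Radm ET) //.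
  by congr cylinder_of; case: (e') g1 g2 => ? ? /= g1 g2;
    rewrite /act_edge /= g1 g2.
case: e => [[[x|Y]|p] [[x'|Y']|p']] //= /main[e' e'E sub]; exists e' => //.
by move=> g /sub[].
Qed.

End Cylinders.

(** * Maps out of a collapse, and the conclusion *)

(* An edge of the collapse is sent to the segment between the images of its
   endpoints, which is unique and hence compatible with the action. *)
Lemma dominates_collapse (G : groupType) (X T : ggraph G) (K : set (X * X))
    (Kact : forall g e, K e -> K (act_edge g e)) (f : X -> T) :
  is_tree T -> (forall g x, f (act g x) = act g (f x)) ->
  (forall x y, adj x y -> K (x, y) -> f x = f y) ->
  dominates (collapse Kact) T.
Proof.
move=> treeT fact fK.
have classf x y : collapse_class K x y -> f x = f y.
  by elim=> [a b [ab Kab]|//|//|a b c _ -> _ ->]; [exact: fK|].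
have /choice[r rP] : forall C : collapse Kact, exists x, val C x.
  by move=> C; have [x _ <-] := set_mem (valP C); exists x; apply: rst_refl.
have fr (C : collapse Kact) x : val C x -> f x = f (r C).
  have := rP C; have [z _ <-] := set_mem (valP C) => zr zx.
  by rewrite -(classf _ _ zr) -(classf _ _ zx).
have /choice[s sP] : forall xy : T * T, exists p, segment xy.1 p xy.2.
  by move=> xy; apply: segment_exists.
(* The representatives [r] need not be equivariant, but [f] is constant on classes. *)
have fA g C : f (r (act g C)) = act g (f (r C)).
  by rewrite -fact; apply/esym/fr; exists (r C).
constructor; apply: (@GMap _ _ _ (fun C => f (r C))
  (fun C D => s (f (r C), f (r D)))) => //.
- by move=> C D _; apply: (sP (_, _)).
- move=> C D _; have [q -> sq] := segment_rev (sP (f (r C), f (r D))).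
  by congr cons; apply: segment_unique sq => //; apply: (sP (_, _)).
- move=> g C D _; have := segment_act g (sP (f (r C), f (r D))).
  apply: segment_unique => //=; rewrite -!fA; exact: (sP (_, _)).
Qed.

Theorem proposition5p12 (G : groupType) (E : set (set G))
    (I : Type) (H : I -> set G) (R : set G -> set G -> Prop)
    (Gfg : finitely_generated G)
    (Esub : forall A, E A -> is_subgroup A)
    (Econj : conj_invariant E)
    (Hsub : forall i, is_subgroup (H i))
    (Requiv : equivalence_on E R)
    (Radm : admissible E H R)
    (Esandwich : sandwich_closed E)
    (T : ggraph G) (ET : is_Etree E T) (HT : forall i, elliptic T (H i))
    (T' : ggraph G) (ET' : is_Etree E T') (TT' : dominates T T')
    (cylT' : forall Y, cylinders R T' Y -> bounded (cylinder_points Y)) :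
  dominates (collapsed_tree_of_cylinders Econj Radm ET) T'.
Proof.
have [f] := TT'.
have HT' i : elliptic T' (H i).
  by have [x Hx] := HT i; exists (mapv f x) => g Hg; rewrite -mapv_act Hx.
have [phi phiA] : exists phi : tree_of_cylinders Radm ET -> T',
    forall g v, phi (act g v) = act g (phi v).
  apply: equivariant_map => -[[x|Y]|p].
  - exists (mapv f (val x)) => g [/(congr1 val)/= gx].
    by rewrite -mapv_act gx.
  - have [y Yy] := cylinder_stab_elliptic Econj Requiv Radm ET ET' HT' TT' cylT'
      (set_mem (valP Y)).
    by exists y => g [/(congr1 val)/= gY]; apply: Yy.
  (* The extra vertex exists only when [T] is a single point, which all of [G] fixes. *)
  - have [[x] _ _ _] := ET.1; exists (mapv f x) => g _.
    by rewrite -mapv_act (set_mem (valP p) (act g x) x).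
apply: dominates_collapse ET'.1 (phiA) _ => u v uv /= nE.
apply/eqP; apply: contraT => /eqP neq; case: nE.
have [e eE sube] := Tc_edge_stab Requiv (e := (u, v)) uv.
have [||e' e'E sube'] := @fixes_edge _ _ (edge_stab (u, v)) _ _ ET'.1 _ _ neq.
- by move=> g [gu _]; rewrite -phiA gu.
- by move=> g [_ gv]; rewrite -phiA gv.
apply: Esandwich sube sube'; [exact: ET.2|exact: ET'.2|].
exact: edge_stab_subgroup.
Qed.
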